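(* Let $X=(x_{ij})_{1\le i<j\le n}$ be a row vector of length $\binom n2$. 1. $F(\hat X)=\hat X$ if and only if $A_2X^\dagger=X^\dagger$. 2. For nonnegative $X$ (all $x_{ij}\ge0$), $G(\hat X)=\hat X$ if and only if $XA_2=X$.
   Context: Setting: $A=\frac12(R+B)$, where $2A$ is the adjacency matrix of a 2-out-regular directed graph on $n$ vertices, strongly connected and aperiodic, and $R,B$ are $n\times n$ binary stochastic matrices (entries $0,1$, exactly one $1$ in each row). $\Delta=\frac12(R-B)$. The field of scalars is $\mathbb Q$; $Y^*$ denotes transpose and $X^\dagger$ is the column vector corresponding to the row vector $X$. For a vector $X$ with components $x_{ij}$ indexed by pairs $i<j$, $\hat X$ is the symmetric $n\times n$ matrix with zero diagonal and $\hat X_{ij}=\hat X_{ji}=x_{ij}$ for $i<j$. For an $n\times n$ matrix $W$, $W^{\vee2}$ is the $\binom n2\times\binom n2$ matrix indexed by pairs with entries $(W^{\vee2})_{ab,cd}=W_{ac}W_{bd}+W_{ad}W_{bc}$ for $a<b$, $c<d$. $A_2=\frac12(R^{\vee2}+B^{\vee2})$. The maps $F,G$ on symmetric $n\times n$ matrices are $$F(Y)=AYA^*+\Delta Y\Delta^*=\tfrac12(RYR^*+BYB^* ),\qquad G(Y)=A^*YA+\Delta^*Y\Delta=\tfrac12(R^*YR+B^*YB).$$ *)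

(* Defs.v *)
From mathcomp Require Import all_boot all_order all_algebra.
From mathcomp Require Import ring.

Set Implicit Arguments.
Unset Strict Implicit.
Unset Printing Implicit Defensive.

Import Order.TTheory GRing.Theory Num.Theory.

Local Open Scope ring_scope.

(* Directed graphs on 'I_n are given by adjacency matrices M : 'M[nat]_n, M i j
   being the number of edges from i to j, so parallel edges and loops are
   allowed. *)
Definition out_regular (n k : nat) (M : 'M[nat]_n) : Prop :=
  forall i : 'I_n, (\sum_(j < n) M i j)%N = k.

Definition edge (n : nat) (M : 'M[nat]_n) : rel 'I_n :=
  [rel i j | (0 < M i j)%N].

Definition strongly_connected (n : nat) (M : 'M[nat]_n) : Prop :=
  forall i j : 'I_n, connect (edge M) i j.

(* The greatest common divisor of all cycle lengths is 1. The empty sequence is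
   a cycle for the library, but its size 0 puts no constraint on d. *)
Definition aperiodic (n : nat) (M : 'M[nat]_n) : Prop :=
  forall d : nat,
    (forall c : seq 'I_n, cycle (edge M) c -> (d %| size c)%N) -> d = 1%N.

Definition binary_stochastic (n : nat) (W : 'M[rat]_n) : Prop :=
  (forall i j : 'I_n, W i j = 0 \/ W i j = 1) /\
  (forall i : 'I_n, exists! j : 'I_n, W i j = 1).

Definition mxA (n : nat) (R B : 'M[rat]_n) : 'M[rat]_n := 2^-1 *: (R + B).

Definition mxDelta (n : nat) (R B : 'M[rat]_n) : 'M[rat]_n := 2^-1 *: (R - B).

Definition mapF (n : nat) (R B Y : 'M[rat]_n) : 'M[rat]_n :=
  mxA R B *m Y *m (mxA R B)^T + mxDelta R B *m Y *m (mxDelta R B)^T.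

Definition mapG (n : nat) (R B Y : 'M[rat]_n) : 'M[rat]_n :=
  (mxA R B)^T *m Y *m mxA R B + (mxDelta R B)^T *m Y *m mxDelta R B.

(* Pairs i < j; vectors and matrices indexed by pairs use the library's
   enumeration of this finite type, through enum_rank and enum_val. *)
Definition opair (n : nat) : finType :=
  {p : 'I_n * 'I_n | (p.1 < p.2)%N}.

Definition npairs (n : nat) : nat := #|opair n|.

(* The component x_ij of X when i < j, and 0 otherwise. *)
Definition pair_entry (n : nat) (X : 'rV[rat]_(npairs n)) (i j : 'I_n) : rat :=
  if insub (i, j) is Some p then X 0 (enum_rank (p : opair n)) else 0.

Definition hat (n : nat) (X : 'rV[rat]_(npairs n)) : 'M[rat]_n :=
  \matrix_(i < n, j < n)
    if (i < j)%N then pair_entry X i j else if (j < i)%N then pair_entry X j i else 0.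

Definition vee2 (n : nat) (W : 'M[rat]_n) : 'M[rat]_(npairs n) :=
  \matrix_(p < npairs n, q < npairs n)
    let: (a, b) := val (enum_val p : opair n) in
    let: (c, d) := val (enum_val q : opair n) in
    W a c * W b d + W a d * W b c.

Definition mxA2 (n : nat) (R B : 'M[rat]_n) : 'M[rat]_(npairs n) :=
  2^-1 *: (vee2 R + vee2 B).

Lemma npairsE (n : nat) : npairs n = 'C(n, 2).
Proof.
rewrite /npairs /opair card_sig -(card_ltn_sorted_tuples 2 n).
rewrite -(card_imset _ (f := fun p : 'I_n * 'I_n => [tuple p.1; p.2])); last first.
  by move=> [a b] [c d] [] /= -> ->.
apply: eq_card => t; apply/imsetP/idP => [[[a b] + ->]|].
  by rewrite !inE /= andbT.
case/tupleP: t => a t; case/tupleP: t => b t; rewrite tuple0 inE /= andbT => ab.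
by exists (a, b); rewrite ?inE //; apply: val_inj.
Qed.

Lemma hat_opair (n : nat) (X : 'rV[rat]_(npairs n)) (p : opair n) :
  hat X (val p).1 (val p).2 = X 0 (enum_rank p).
Proof.
case: p => [[i j] ij] /=; rewrite mxE ij /pair_entry insubT /=.
by congr (X 0 (enum_rank _)); apply: val_inj.
Qed.

Lemma half_sandwich (n : nat) (R B Y S T : 'M[rat]_n) :
  2^-1 *: (R + B) *m Y *m (2^-1 *: (S + T))
    + 2^-1 *: (R - B) *m Y *m (2^-1 *: (S - T))
  = 2^-1 *: (R *m Y *m S + B *m Y *m T).
Proof.
rewrite -!scalemxAl -!scalemxAr !mulmxDl !mulmxDr !mulNmx !mulmxN.
by apply/matrixP => i j; rewrite !mxE; field.
Qed.

Lemma mapFE (n : nat) (R B Y : 'M[rat]_n) :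
  mapF R B Y = 2^-1 *: (R *m Y *m R^T + B *m Y *m B^T).
Proof.
rewrite /mapF /mxA /mxDelta ![(2^-1 *: _)^T]linearZ /= [(R + B)^T]linearD.
by rewrite [(R - B)^T]linearB /= half_sandwich.
Qed.

Lemma mapGE (n : nat) (R B Y : 'M[rat]_n) :
  mapG R B Y = 2^-1 *: (R^T *m Y *m R + B^T *m Y *m B).
Proof.
rewrite /mapG /mxA /mxDelta ![(2^-1 *: _)^T]linearZ /= [(R + B)^T]linearD.
by rewrite [(R - B)^T]linearB /= half_sandwich.
Qed.

(* Main.v *)
Require Import Defs.
From mathcomp Require Import all_boot all_order all_algebra.

Set Implicit Arguments.
Unset Strict Implicit.
Unset Printing Implicit Defensive.

Import Order.TTheory GRing.Theory Num.Theory.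

Local Open Scope ring_scope.

(** Reading a matrix off at the positions [i < j] inverts [hat] on symmetric
    matrices with zero diagonal, and it turns the congruence [U *m _ *m U^T]
    into multiplication by [(vee2 U)^T], because the two terms of [vee2] collect
    the two symmetric entries of [hat X] ([upper_congr_hat]).  Hence the entries
    above the diagonal of [mapF R B (hat X)] and [mapG R B (hat X)] are those of
    [X *m (mxA2 R B)^T] and [X *m mxA2 R B].  All that separates a fixed point
    of [mapF] or [mapG] from a fixed vector of [mxA2] is the diagonal, which
    vanishes in [hat X].

    For [mapF], a row of a binary stochastic matrix has a single nonzero entry,
    so each diagonal entry of [R *m hat X *m R^T] is itself a diagonal entry of
    [hat X], that is, 0 ([congr_hat_diag]).

    For [mapG] the diagonal need not vanish.  But the rows of [R] and [B] sum
    to 1, so [mapG] preserves the sum of all entries ([mapG_total]).  If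
    [X *m mxA2 R B = X] then [mapG R B (hat X)] and [hat X] agree off the
    diagonal, so the diagonal of the former sums to 0; when [X] is nonnegative
    the diagonal entries are nonnegative too, and all of them vanish. *)

(** * Vectors indexed by pairs and symmetric matrices *)

Definition upper (n : nat) (Y : 'M[rat]_n) : 'rV[rat]_(npairs n) :=
  \row_k Y (val (enum_val k : opair n)).1 (val (enum_val k : opair n)).2.

Lemma upper_hat (n : nat) (X : 'rV[rat]_(npairs n)) : upper (hat X) = X.
Proof. by apply/rowP => k; rewrite mxE hat_opair enum_valK. Qed.

Lemma hat_diag (n : nat) (X : 'rV[rat]_(npairs n)) (i : 'I_n) : hat X i i = 0.
Proof. by rewrite mxE ltnn. Qed.

Lemma hat_tr (n : nat) (X : 'rV[rat]_(npairs n)) : (hat X)^T = hat X.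
Proof. by apply/matrixP => i j; rewrite !mxE; case: ltngtP. Qed.

Lemma hat_ge0 (n : nat) (X : 'rV[rat]_(npairs n)) :
  (forall k, 0 <= X 0 k) -> forall i j, 0 <= hat X i j.
Proof.
move=> X0 i j; rewrite mxE /pair_entry.
by case: ifP => _; [|case: ifP => // _]; case: insub.
Qed.

Lemma hat_upper (n : nat) (Y : 'M[rat]_n) :
  Y^T = Y -> (forall i, Y i i = 0) -> hat (upper Y) = Y.
Proof.
move=> Ysym Ydiag.
have upperE (i j : 'I_n) : (i < j)%N -> hat (upper Y) i j = Y i j.
  move=> ij; have := hat_opair (upper Y) (Sub (i, j) ij : opair n).
  by rewrite [upper Y 0 _]mxE enum_rankK.
apply/matrixP => i j; case: (ltngtP i j) => [/upperE // | ji | /val_inj ->].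
  by rewrite -hat_tr mxE upperE // -[in RHS]Ysym mxE.
by rewrite hat_diag Ydiag.
Qed.

(** A symmetric fixed point is detected above the diagonal as soon as its
    diagonal is known to vanish. *)
Lemma eq_hatP (n : nat) (Y : 'M[rat]_n) (X : 'rV[rat]_(npairs n)) :
  Y^T = Y -> Y = hat X <-> upper Y = X /\ forall i, Y i i = 0.
Proof.
move=> Ysym; split=> [-> | [<- Ydiag]]; last by rewrite hat_upper.
by split=> [|i]; [exact: upper_hat | exact: hat_diag].
Qed.

Lemma sum_opair (n : nat) (f : 'I_n * 'I_n -> rat) :
  \sum_(k < npairs n) f (val (enum_val k : opair n))
  = \sum_(p : 'I_n * 'I_n | (p.1 < p.2)%N) f p.
Proof.
rewrite -(big_enum_val (fun p : opair n => f (val p))) /=.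
rewrite [RHS](reindex_omap (val : opair n -> _) insub) /=; last first.
  by move=> p lt_p; rewrite insubT.
by apply: eq_bigl => p; rewrite valK eqxx andbT (valP p).
Qed.

(** Summing over ordered pairs trades the zero diagonal and the symmetry of
    [hat X] for the symmetrization of the weight [f]. *)
Lemma sum_hat (n : nat) (X : 'rV[rat]_(npairs n)) (f : 'I_n -> 'I_n -> rat) :
  \sum_i \sum_j hat X i j * f i j
  = \sum_(k < npairs n) X 0 k *
      (let p := val (enum_val k : opair n) in f p.1 p.2 + f p.2 p.1).
Proof.
under [RHS]eq_bigr => k _ do
  rewrite -[in X 0 k](enum_valK k) -hat_opair /=.
rewrite (sum_opair (fun p => hat X p.1 p.2 * (f p.1 p.2 + f p.2 p.1))).
rewrite pair_big /= (bigID (fun p : 'I_n * 'I_n => (p.1 < p.2)%N)) /=.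
under [RHS]eq_bigr do rewrite mulrDr.
rewrite big_split /=; congr (_ + _).
(* The diagonal terms vanish; those below the diagonal are swapped. *)
rewrite (bigID (fun p : 'I_n * 'I_n => (p.2 < p.1)%N)) /= [X in _ + X]big1.
  rewrite addr0 (reindex_inj (h := fun p : 'I_n * 'I_n => (p.2, p.1))) /=;
    last by move=> [a b] [c d] [-> ->].
  apply: eq_big => [[i j] | [i j] _] /=; first by case: ltngtP.
  by rewrite -[in LHS]hat_tr mxE.
move=> [i j] /=; case: ltngtP => // /val_inj -> _.
by rewrite hat_diag mul0r.
Qed.

(** * Congruences and the second symmetric power *)

Lemma congr_entry (n : nat) (U Y : 'M[rat]_n) (a b : 'I_n) :
  (U *m Y *m U^T) a b = \sum_c \sum_d Y c d * (U a c * U b d).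
Proof.
rewrite mxE exchange_big /=; apply: eq_bigr => d _.
rewrite !mxE mulr_suml; apply: eq_bigr => c _.
by rewrite mulrA [Y c d * _]mulrC.
Qed.

Lemma vee2E (n : nat) (W : 'M[rat]_n) (k l : 'I_(npairs n)) :
  vee2 W k l =
    let p := val (enum_val k : opair n) in
    let q := val (enum_val l : opair n) in
    W p.1 q.1 * W p.2 q.2 + W p.1 q.2 * W p.2 q.1.
Proof. by rewrite mxE; case: (val _) => a b; case: (val _). Qed.

Lemma vee2_tr (n : nat) (W : 'M[rat]_n) : vee2 W^T = (vee2 W)^T.
Proof.
apply/matrixP => k l; rewrite [RHS]mxE !vee2E /= !mxE.
by congr (_ + _); rewrite mulrC.
Qed.

(** Each unordered pair of indices occurs twice in the matrix product, once in
    either order; these are the two terms of [vee2]. *)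
Lemma upper_congr_hat (n : nat) (U : 'M[rat]_n) (X : 'rV[rat]_(npairs n)) :
  upper (U *m hat X *m U^T) = X *m (vee2 U)^T.
Proof.
apply/rowP => k; rewrite mxE congr_entry sum_hat mxE; apply: eq_bigr => l _.
by rewrite mxE vee2E.
Qed.

Lemma congr_tr (n : nat) (U Y : 'M[rat]_n) :
  Y^T = Y -> (U *m Y *m U^T)^T = U *m Y *m U^T.
Proof. by move=> Ysym; rewrite !trmx_mul trmxK Ysym mulmxA. Qed.

Lemma upper_half_sum (n : nat) (Y Z : 'M[rat]_n) :
  upper (2^-1 *: (Y + Z)) = 2^-1 *: (upper Y + upper Z).
Proof. by apply/rowP => k; rewrite !mxE. Qed.

Lemma upper_mapF (n : nat) (R B : 'M[rat]_n) (X : 'rV[rat]_(npairs n)) :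
  upper (mapF R B (hat X)) = X *m (mxA2 R B)^T.
Proof.
rewrite mapFE upper_half_sum !upper_congr_hat /mxA2.
by rewrite -mulmxDr scalemxAr -linearD -linearZ.
Qed.

(** Transposing [R] and [B] transposes [mxA2], so the facts about [mapF] that
    hold for arbitrary matrices transfer to [mapG]. *)
Lemma mapG_mapF (n : nat) (R B Y : 'M[rat]_n) : mapG R B Y = mapF R^T B^T Y.
Proof. by rewrite mapGE mapFE !trmxK. Qed.

Lemma upper_mapG (n : nat) (R B : 'M[rat]_n) (X : 'rV[rat]_(npairs n)) :
  upper (mapG R B (hat X)) = X *m mxA2 R B.
Proof.
rewrite mapG_mapF upper_mapF /mxA2 !vee2_tr -linearD -linearZ /=.
by rewrite trmxK.
Qed.

Lemma mapF_hat_tr (n : nat) (R B : 'M[rat]_n) (X : 'rV[rat]_(npairs n)) :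
  (mapF R B (hat X))^T = mapF R B (hat X).
Proof. by rewrite mapFE linearZ linearD /= !congr_tr ?hat_tr. Qed.

(** * Binary stochastic matrices and the diagonal *)

Lemma binary_stochastic_ge0 (n : nat) (W : 'M[rat]_n) :
  binary_stochastic W -> forall i j, 0 <= W i j.
Proof. by case=> W01 _ i j; case: (W01 i j) => ->. Qed.

Lemma binary_stochastic_row (n : nat) (W : 'M[rat]_n) (i : 'I_n) :
  binary_stochastic W -> exists r, forall j, W i j = (j == r)%:R.
Proof.
case=> W01 /(_ i) [r [Wr Wuniq]]; exists r => j.
have [-> // | neq_jr] := eqVneq.
by case: (W01 i j) => // /Wuniq rj; rewrite rj eqxx in neq_jr.
Qed.

Lemma row_sum1 (n : nat) (W : 'M[rat]_n) (i : 'I_n) :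
  binary_stochastic W -> \sum_j W i j = 1.
Proof.
move=> /(binary_stochastic_row i) [r Wr].
rewrite (bigD1 r) //= Wr eqxx big1 ?addr0 // => j neq_jr.
by rewrite Wr (negPf neq_jr).
Qed.

(** The product [W a c * W a d] forces [c = d], where [hat X] vanishes. *)
Lemma congr_hat_diag (n : nat) (W : 'M[rat]_n) (X : 'rV[rat]_(npairs n)) a :
  binary_stochastic W -> (W *m hat X *m W^T) a a = 0.
Proof.
move=> /(binary_stochastic_row a) [r Wr].
rewrite congr_entry; apply: big1 => c _; apply: big1 => d _; rewrite !Wr.
have [-> | _] := eqVneq c r; last by rewrite mul0r mulr0.
have [-> | _] := eqVneq d r; last by rewrite !mulr0.
by rewrite hat_diag mul0r.
Qed.

(** The sum of all entries is [u *m Z *m u^T] for the all-ones row [u], and the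
    row sums of [W] say that [W] fixes [u^T]. *)
Lemma congr_total (n : nat) (W Y : 'M[rat]_n) :
  binary_stochastic W ->
  \sum_c \sum_d (W^T *m Y *m W) c d = \sum_a \sum_b Y a b.
Proof.
move=> Wbin.
have total (Z : 'M[rat]_n) :
    \sum_c \sum_d Z c d = (const_mx 1 *m Z *m const_mx 1 : 'M_1) 0 0.
  rewrite mxE exchange_big; apply: eq_bigr => d _; rewrite !mxE mulr1.
  by apply: eq_bigr => c _; rewrite mxE mul1r.
have W1 : W *m const_mx 1 = const_mx 1 :> 'cV_n.
  apply/colP => i; rewrite !mxE -[RHS](row_sum1 i Wbin).
  by apply: eq_bigr => j _; rewrite mxE mulr1.
have W1t : const_mx 1 *m W^T = const_mx 1 :> 'rV_n.
  by rewrite -trmx_const -trmx_mul W1.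
by rewrite !total !mulmxA W1t -mulmxA W1.
Qed.

Lemma mapG_total (n : nat) (R B Y : 'M[rat]_n) :
  binary_stochastic R -> binary_stochastic B ->
  \sum_c \sum_d mapG R B Y c d = \sum_a \sum_b Y a b.
Proof.
move=> Rbin Bbin; rewrite mapGE.
under eq_bigr => c _.
  under eq_bigr => d _ do rewrite mxE mxE.
  rewrite -mulr_sumr big_split /=; over.
rewrite -mulr_sumr big_split /= !congr_total // -mulr2n -[X in _ * X]mulr_natl.
by rewrite mulrA mulVf ?mul1r.
Qed.

Lemma mapG_ge0 (n : nat) (R B Y : 'M[rat]_n) :
  binary_stochastic R -> binary_stochastic B ->
  (forall a b, 0 <= Y a b) -> forall c d, 0 <= mapG R B Y c d.
Proof.
move=> Rbin Bbin Y0 c d.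
have congr_ge0 W : binary_stochastic W -> 0 <= (W^T *m Y *m W) c d.
  move=> /binary_stochastic_ge0 W0; rewrite -[W in _ *m W]trmxK congr_entry.
  by do 2![apply: sumr_ge0 => ? _]; rewrite !mxE !mulr_ge0.
by rewrite mapGE mxE mulr_ge0 ?invr_ge0 // mxE addr_ge0 ?congr_ge0.
Qed.

(** Off the diagonal [Y] and [hat (upper Y)] agree, so the two totals differ by
    the trace of [Y]; nonnegative entries summing to 0 are all 0. *)
Lemma diag0_of_total (n : nat) (Y : 'M[rat]_n) :
  Y^T = Y -> (forall i, 0 <= Y i i) ->
  \sum_i \sum_j Y i j = \sum_i \sum_j hat (upper Y) i j ->
  forall i, Y i i = 0.
Proof.
move=> Ysym Ydiag_ge0 total.
pose D := \matrix_(i, j) (Y i i *+ (i == j)).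
have YDE : Y - D = hat (upper Y).
  apply/eq_hatP.
    rewrite linearB /= Ysym; congr (_ - _); apply/matrixP => i j.
    by rewrite !mxE eq_sym; case: eqP => [-> |].
  split=> [|i]; last by rewrite !mxE eqxx subrr.
  apply/rowP => k; rewrite !mxE -val_eqE ltn_eqF ?subr0 //.
  exact: (valP (enum_val k)).
have /eqP : \sum_i Y i i = 0.
  move: total; rewrite -YDE.
  under [RHS]eq_bigr => i _.
    under eq_bigr => j _ do rewrite mxE [(- D) i j]mxE.
    rewrite sumrB; over.
  rewrite sumrB => /esym/eqP; rewrite addrC -subr_eq0 addrK oppr_eq0 => /eqP D0.
  rewrite -[RHS]D0; apply: eq_bigr => i _; rewrite (bigD1 i) //= mxE eqxx big1 ?addr0 // => j.
  by rewrite mxE eq_sym => /negPf ->.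
by rewrite psumr_eq0 // => /allP Y0 i; apply/eqP/Y0/mem_index_enum.
Qed.

Theorem theorem9p12 (n : nat) (M : 'M[nat]_n) (R B : 'M[rat]_n)
    (Mreg : out_regular 2 M) (Mconn : strongly_connected M)
    (Maper : aperiodic M)
    (Rbin : binary_stochastic R) (Bbin : binary_stochastic B)
    (AM : 2 *: mxA R B = \matrix_(i < n, j < n) (M i j)%:R)
    (X : 'rV[rat]_(npairs n)) :
  (mapF R B (hat X) = hat X <-> mxA2 R B *m X^T = X^T) /\
  ((forall k : 'I_(npairs n), 0 <= X 0 k) ->
     (mapG R B (hat X) = hat X <-> X *m mxA2 R B = X)).
Proof.
split=> [|X_ge0].
  have A2E : mxA2 R B *m X^T = (X *m (mxA2 R B)^T)^T.
    by rewrite trmx_mul trmxK.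
  rewrite (eq_hatP _ (mapF_hat_tr _ _ _)) upper_mapF A2E.
  split=> [[-> //] | /trmx_inj ->]; split=> // i.
  by rewrite mapFE mxE mxE !congr_hat_diag // addr0 mulr0.
have Gsym : (mapG R B (hat X))^T = mapG R B (hat X).
  by rewrite mapG_mapF mapF_hat_tr.
rewrite (eq_hatP _ Gsym) upper_mapG; split=> [[] // | XA2]; split=> //.
apply: (diag0_of_total Gsym) => [i|].
  by apply: mapG_ge0 => //; apply: hat_ge0.
by rewrite upper_mapG XA2 mapG_total.
Qed.
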